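(* Let $N$ be a positive integer, let $k$ be a field, and let $\mathcal{L}_N^{\geqslant 0}$ denote the category of positive $N$-complexes of finite dimensional $k$-vector spaces. Let $M$ be a positive $N$-complex of finite dimensional vector spaces, let $a$ be an amplitude ($1\le a\le N-1$), and let $b=N-a$ be the coamplitude. Let $j\ge0$ be an integer, with euclidean division $j=qN+e$, $0\le e\le N-1$. Then for $e<b$ we have $$(AH)_a^j(M)\cong\mathrm{Ext}^{2q}_{\mathcal{L}_N^{\geqslant0}}(M_e^{a-1},M),$$ and for $e\ge b$ we have $$(AH)_a^j(M)\cong\mathrm{Ext}^{2q+1}_{\mathcal{L}_N^{\geqslant0}}(M_{e-b}^{b-1},M).$$
   Context: An $N$-complex is a $\mathbb{Z}$-graded $k$-vector space $\{{}_iM\}_{i\in\mathbb{Z}}$ together with linear maps $d_i:{}_iM\to{}_{i+1}M$ such that $d_{i+N-1}\circ\dots\circ d_i=0$ for each $i\in\mathbb{Z}$. Morphisms are degree-preserving linear maps commuting with the $d_i$. An $N$-complex $M$ is positive if ${}_iM=0$ for all $i\le-1$. ''Of finite dimensional vector spaces'' means that each ${}_iM$ is finite dimensional. $\mathrm{Ext}$ is computed in the abelian category $\mathcal{L}_N^{\geqslant0}$. For $i\in\mathbb{Z}$ and $0\le l\le N-1$, $M_i^l$ is the $N$-complex with ${}_j(M_i^l)=k$ for $i\le j\le i+l$ and ${}_j(M_i^l)=0$ otherwise, where $d_i,\dots,d_{i+l-1}$ are the identity and all other $d_j$ are zero. For $1\le a\le N-1$ and $i\in\mathbb{Z}$, the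 amplitude cohomology is $$(AH)_a^i(M):=\ker(d_{i+a-1}\circ\dots\circ d_i)/\mathrm{im}(d_{i-1}\circ\dots\circ d_{i-N+a}).$$ *)

(* Defs.v *)
From HB Require Import structures.
From mathcomp Require Import all_boot all_order all_algebra.
From mathcomp Require Import boolp.
From mathcomp Require Import zify.

Set Implicit Arguments.
Unset Strict Implicit.
Unset Printing Implicit Defensive.

Import Order.TTheory GRing.Theory Num.Theory.

Local Open Scope ring_scope.

(* Homology [ker g / im f] of a pair of linear maps U -f-> V -g-> W.          *)
Section Homology.
Variables (k : fieldType) (U V W : lmodType k).
Variables (f : {linear U -> V}) (g : {linear V -> W}).

Definition lin_ker : {pred V} := fun v => g v == 0.

Lemma lin_ker_submod_closed : submod_closed lin_ker.
Proof.
split=> [|a u v]; rewrite !unfold_in ?linear0 //.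
by move=> /eqP gu /eqP gv; rewrite linearP gu gv scaler0 addr0.
Qed.
HB.instance Definition _ :=
  GRing.isSubmodClosed.Build k V lin_ker lin_ker_submod_closed.

Record cycle := Cycle { cycle_val : V; _ : cycle_val \in lin_ker }.
HB.instance Definition _ := [isSub for cycle_val].
HB.instance Definition _ := [Choice of cycle by <:].
HB.instance Definition _ := [SubChoice_isSubLmodule of cycle by <:].

Definition lin_im : {pred cycle} := fun z => `[< exists u, f u = val z >].

Lemma lin_im_submod_closed : submod_closed lin_im.
Proof.
split=> [|a u v]; rewrite !unfold_in.
  by apply/asboolP; exists 0; rewrite !linear0.
move=> /asboolP[x fx] /asboolP[y fy]; apply/asboolP; exists (a *: x + y).
by rewrite linearP fx fy linearP.
Qed.
HB.instance Definition _ :=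
  GRing.isSubmodClosed.Build k cycle lin_im lin_im_submod_closed.

Definition homology : Type := Quotient.quot lin_im.
HB.instance Definition _ := GRing.Zmodule.on homology.

Definition homology_class (z : cycle) : homology := (\pi_(Quotient.quot lin_im) z)%qT.

Definition homology_scale (a : k) (x : homology) : homology :=
  homology_class (a *: (repr (x : Quotient.quot lin_im))).

Lemma homology_classP z t :
  homology_class z = homology_class t <-> exists u, f u = val z - val t.
Proof.
rewrite /homology_class; split.
  by move/eqP; rewrite -Quotient.idealrBE => /asboolP[u fu]; exists u; rewrite fu raddfB.
move=> [u fu]; apply/eqP; rewrite -Quotient.idealrBE.
by apply/asboolP; exists u; rewrite fu raddfB.
Qed.

Lemma homology_ind (x : homology) : exists z, x = homology_class z.
Proof. by exists (repr (x : Quotient.quot lin_im)); rewrite /homology_class reprK. Qed.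

Lemma homology_classD z t :
  homology_class (z + t) = homology_class z + homology_class t.
Proof. exact: raddfD. Qed.

Lemma homology_classZ a z :
  homology_class (a *: z) = homology_scale a (homology_class z).
Proof.
apply/homology_classP.
have /homology_classP[u fu] :
    homology_class z = homology_class (repr (\pi_(Quotient.quot lin_im) z)%qT).
  by rewrite /homology_class reprK.
by exists (a *: u); rewrite linearZ /= fu scalerBr !linearZ.
Qed.

Fact homology_scaleA a b x :
  homology_scale a (homology_scale b x) = homology_scale (a * b) x.
Proof. by have [z ->] := homology_ind x; rewrite -!homology_classZ scalerA. Qed.

Fact homology_scale1 : left_id 1 homology_scale.
Proof.
by move=> x; have [z ->] := homology_ind x; rewrite -!homology_classZ scale1r.
Qed.

Fact homology_scaleDr : right_distributive homology_scale +%R.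
Proof.
move=> a x y; have [z ->] := homology_ind x; have [t ->] := homology_ind y.
by rewrite -homology_classD -!homology_classZ scalerDr homology_classD.
Qed.

Fact homology_scaleDl x : {morph homology_scale^~ x : a b / a + b}.
Proof.
move=> a b; have [z ->] := homology_ind x.
by rewrite -!homology_classZ scalerDl homology_classD.
Qed.

HB.instance Definition _ := GRing.Zmodule_isLmodule.Build k homology
  homology_scaleA homology_scale1 homology_scaleDr homology_scaleDl.

End Homology.

Definition lmod_iso (k : fieldType) (A B : lmodType k) : Prop :=
  exists f : {linear A -> B}, bijective f.

(* [diter d n i j] is the composite d_(j-1) \o ... \o d_i of n maps when       *)
(* j = i + n, and the junk value 0 otherwise.                                  *)
Fixpoint diter (k : fieldType) (M : int -> vectType k)
    (d : forall i, 'Hom(M i, M (i + 1))) (n : nat) (i j : int) : 'Hom(M i, M j) :=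
  match n with
  | 0 => if @eqP _ i j is ReflectT e then ecast z 'Hom(M i, M z) e \1%VF else 0
  | n'.+1 => (diter d n' (i + 1) j \o d i)%VF
  end.

(* N-complexes of finite dimensional k-vector spaces.                          *)
Record Ncomplex (k : fieldType) (N : nat) := NComplex {
  nobj :> int -> vectType k;
  ndiff : forall i, 'Hom(nobj i, nobj (i + 1));
  ndiffN : forall i, diter ndiff N i (i + N%:Z) = 0
}.

Definition positive (k : fieldType) (N : nat) (M : Ncomplex k N) : Prop :=
  forall i : int, i <= -1 -> \dim {: M i} = 0%N.

(* The objects of L_N^{>=0}; its morphisms are those of the underlying         *)
(* N-complexes, [mor] below.                                                   *)
Record posNcomplex (k : fieldType) (N : nat) := PosNComplex {
  pos_cx :> Ncomplex k N;
  pos_cxP : positive pos_cx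
}.

Record mor (k : fieldType) (N : nat) (X Y : Ncomplex k N) := Mor {
  mor_fun :> forall i, 'Hom(X i, Y i);
  mor_comm : forall i, (mor_fun (i + 1) \o ndiff X i = ndiff Y i \o mor_fun i)%VF
}.

Section MorLmodule.
Variables (k : fieldType) (N : nat) (X Y : Ncomplex k N).

Lemma morP (f g : mor X Y) : (forall i, f i = g i) -> f = g.
Proof.
case: f g => [f fc] [g gc] /= fg.
have {}fg : f = g by apply: functional_extensionality_dep.
by case: _ / fg gc => gc; rewrite (Prop_irrelevance fc gc).
Qed.

HB.instance Definition _ := gen_eqMixin (mor X Y).
HB.instance Definition _ := gen_choiceMixin (mor X Y).

Fact mor0_comm i : (0 \o ndiff X i = ndiff Y i \o 0)%VF.
Proof. by rewrite comp_lfun0l comp_lfun0r. Qed.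
Definition mor0 : mor X Y := Mor mor0_comm.

Fact morN_comm (f : mor X Y) i :
  ((- f (i + 1)%R) \o ndiff X i = ndiff Y i \o (- f i))%VF.
Proof. by rewrite comp_lfunNl comp_lfunNr mor_comm. Qed.
Definition morN f : mor X Y := Mor (morN_comm f).

Fact morD_comm (f g : mor X Y) i :
  ((f (i + 1)%R + g (i + 1)%R)%R \o ndiff X i = ndiff Y i \o (f i + g i)%R)%VF.
Proof. by rewrite comp_lfunDl comp_lfunDr !mor_comm. Qed.
Definition morD f g : mor X Y := Mor (morD_comm f g).

Fact morZ_comm a (f : mor X Y) i :
  ((a *: f (i + 1)%R) \o ndiff X i = ndiff Y i \o (a *: f i))%VF.
Proof. by rewrite -comp_lfunZl -comp_lfunZr mor_comm. Qed.
Definition morZ a f : mor X Y := Mor (morZ_comm a f).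

Fact morDA : associative morD. Proof. by move=> *; apply: morP => i /=; rewrite addrA. Qed.
Fact morDC : commutative morD. Proof. by move=> *; apply: morP => i /=; rewrite addrC. Qed.
Fact mor0D : left_id mor0 morD. Proof. by move=> *; apply: morP => i /=; rewrite add0r. Qed.
Fact morND : left_inverse mor0 morN morD.
Proof. by move=> *; apply: morP => i /=; rewrite addNr. Qed.
HB.instance Definition _ := GRing.isZmodule.Build (mor X Y) morDA morDC mor0D morND.

Fact morZA a b f : morZ a (morZ b f) = morZ (a * b) f.
Proof. by apply: morP => i /=; rewrite scalerA. Qed.
Fact mor1Z : left_id 1 morZ. Proof. by move=> *; apply: morP => i /=; rewrite scale1r. Qed.
Fact morZDr : right_distributive morZ +%R.
Proof. by move=> *; apply: morP => i /=; rewrite scalerDr. Qed.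
Fact morZDl f : {morph morZ^~ f : a b / a + b}.
Proof. by move=> *; apply: morP => i /=; rewrite scalerDl. Qed.
HB.instance Definition _ := GRing.Zmodule_isLmodule.Build k (mor X Y) morZA mor1Z morZDr morZDl.

End MorLmodule.

Section MorComp.
Variables (k : fieldType) (N : nat) (X Y Z : Ncomplex k N).

Fact mor_comp_comm (g : mor Y Z) (f : mor X Y) i :
  ((g (i + 1)%R \o f (i + 1)%R) \o ndiff X i = ndiff Z i \o (g i \o f i))%VF.
Proof. by rewrite -comp_lfunA mor_comm !comp_lfunA mor_comm. Qed.
Definition mor_comp g f : mor X Z := Mor (mor_comp_comm g f).

(* Hom(f, Z) : Hom(Y, Z) -> Hom(X, Z) *)
Definition precomp (f : mor X Y) (g : mor Y Z) : mor X Z := mor_comp g f.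

Fact precomp_is_linear f : linear (precomp f).
Proof. by move=> a g h; apply: morP => i /=; rewrite comp_lfunDl -comp_lfunZl. Qed.
HB.instance Definition _ f :=
  GRing.isLinear.Build k (mor Y Z) (mor X Z) _ (precomp f) (precomp_is_linear f).

End MorComp.

Section ProjectiveResolutions.
Variables (k : fieldType) (N : nat).
Implicit Types X Y P A B : posNcomplex k N.

Definition surjective_mor A B (g : mor A B) : Prop := forall i, limg (g i) = fullv.

Definition exact_at (X Y Z : posNcomplex k N) (f : mor X Y) (g : mor Y Z) : Prop :=
  forall i, limg (f i) = lker (g i).

Definition projective P : Prop :=
  forall A B (g : mor A B) (h : mor P B), surjective_mor g ->
  exists h' : mor P A, mor_comp g h' = h.

(* ... -> P_2 -> P_1 -> P_0 -> X -> 0 *)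
Record projres X := ProjRes {
  pr_obj : nat -> posNcomplex k N;
  pr_diff : forall n, mor (pr_obj n.+1) (pr_obj n);
  pr_aug : mor (pr_obj 0) X;
  pr_projective : forall n, projective (pr_obj n);
  pr_aug_surj : surjective_mor pr_aug;
  pr_exact0 : exact_at (pr_diff 0) pr_aug;
  pr_exactS : forall n, exact_at (pr_diff n.+1) (pr_diff n)
}.

(* H^n(Hom(P, Y)), with Hom(P, Y) extended by zero in degree -1 *)
Definition ext_of_res X (P : projres X) (n : nat) Y : lmodType k :=
  match n with
  | 0 => homology (\0 : mor (pr_obj P 0) Y -> mor (pr_obj P 0) Y)
                  (precomp (pr_diff P 0))
  | n'.+1 => homology (precomp (Z := Y) (pr_diff P n'))
                      (precomp (pr_diff P n'.+1))
  end.

End ProjectiveResolutions.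

(* Amplitude cohomology: ker (d_(i+a-1) \o ... \o d_i) modulo                  *)
(* im (d_(i-1) \o ... \o d_(i-N+a)).                                           *)
Definition AH (k : fieldType) (N : nat) (M : Ncomplex k N) (a : nat) (i : int) : lmodType k :=
  homology (diter (ndiff M) (N - a) (i - (N - a)%N%:Z) i)
           (diter (ndiff M) a i (i + a%:Z)).

Section DiterTheory.
Variables (k : fieldType) (M : int -> vectType k).
Variable d : forall i, 'Hom(M i, M (i + 1)).

Lemma diter0 i : diter d 0 i i = \1%VF.
Proof. by rewrite /=; case: eqP => // e; rewrite (eq_axiomK e). Qed.

Lemma diterSr n i j : j = i + n%:Z ->
  diter d n.+1 i (j + 1) = (d j \o diter d n i j)%VF.
Proof.
elim: n i j => [|n IHn] i j ej; last first.
  by rewrite -[LHS]/(diter d n.+1 (i + 1) (j + 1) \o d i)%VF IHn ?comp_lfunA //; lia.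
have {}ej : j = i by lia.
by subst j; rewrite -[LHS]/(diter d 0 (i + 1) (i + 1) \o d i)%VF !diter0
  comp_lfun1l comp_lfun1r.
Qed.

Lemma diter_over n m i j :
  (forall i, diter d n i (i + n%:Z) = 0) -> (n <= m)%N -> diter d m i j = 0.
Proof.
move=> dn; elim: m i => [|m IHm] i.
  rewrite leqn0 => /eqP n0; have := dn i; rewrite n0 addr0 diter0 /= => d0.
  by case: eqP => // e; subst j.
rewrite leq_eqVlt => /predU1P[nm|]; last by move=> /IHm /= ->; rewrite comp_lfun0l.
subst n; case: (j =P i + m.+1%:Z) => [->//|ne].
elim: m.+1 i ne {IHm dn} => [|p IHp] i ne.
  by rewrite /=; case: eqP => // e; case: ne; rewrite addr0 e.
by rewrite /= IHp ?comp_lfun0l //; lia.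
Qed.

End DiterTheory.

Lemma mor_diter (k : fieldType) (N : nat) (X Y : Ncomplex k N) (f : mor X Y) n i j :
  (f j \o diter (ndiff X) n i j = diter (ndiff Y) n i j \o f i)%VF.
Proof.
elim: n i => [|n IHn] i /=.
  by case: eqP => [e|_]; [subst j; rewrite comp_lfun1l comp_lfun1r
    | rewrite comp_lfun0l comp_lfun0r].
by rewrite comp_lfunA IHn -comp_lfunA mor_comm comp_lfunA.
Qed.

(* The complex M_i^l, with k = 'rV[k]_1 in degrees i <= j <= i + l, 'rV[k]_0   *)
(* elsewhere; pid_mx 1 is the identity between two copies of 'rV[k]_1 and is   *)
(* the only (zero) map otherwise.                                              *)
Section Interval.
Variables (k : fieldType) (N : nat) (i : int) (l : nat) (lN : (l < N)%N).

Definition interval_supp (j : int) : bool := i <= j <= i + l%:Z.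

Definition interval_obj (j : int) : vectType k := 'rV[k]_(interval_supp j).

Definition interval_diff (j : int) : 'Hom(interval_obj j, interval_obj (j + 1)) :=
  linfun (mulmxr (pid_mx 1)).

Lemma interval_objN j (v : interval_obj j) : ~~ interval_supp j -> v = 0.
Proof.
move: v; rewrite /interval_obj; case: (interval_supp j) => // v _.
exact: thinmx0.
Qed.

Fact interval_diffN j : diter interval_diff N j (j + N%:Z) = 0.
Proof.
apply/lfunP => v; rewrite lfunE /=.
have [sj|nsj] := boolP (interval_supp j); last by rewrite (interval_objN v nsj) linear0.
by apply: interval_objN; move: sj; rewrite /interval_supp; lia.
Qed.

Definition interval_cx : Ncomplex k N := NComplex interval_diffN.

End Interval.

Arguments interval_cx k {N} i l lN.

Fact interval_cx_pos (k : fieldType) (N i l : nat) (lN : (l < N)%N) :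
  positive (interval_cx k i%:Z l lN).
Proof.
move=> j j0; apply/eqP; rewrite dimv_eq0 -subv0; apply/subvP => v _.
by rewrite (@interval_objN _ _ _ _ v) ?mem0v // /interval_supp; lia.
Qed.

Definition interval_pcx (k : fieldType) (N i l : nat) (lN : (l < N)%N) : posNcomplex k N :=
  PosNComplex (interval_cx_pos k i lN).
Arguments interval_pcx k {N} i l lN.

Section Kernel.
Variables (k : fieldType) (N : nat) (X Y : posNcomplex k N) (f : mor X Y).

Definition ker_obj i : vectType k := subvs_of (lker (f i)).

Definition ker_diff i : 'Hom(ker_obj i, ker_obj (i + 1)) :=
  linfun (vsproj (lker (f (i + 1))) \o ndiff X i \o vsval).

Fact ker_diff_val i (v : ker_obj i) : vsval (ker_diff i v) = ndiff X i (vsval v).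
Proof.
rewrite lfunE /= vsprojK // memv_ker -comp_lfunE mor_comm comp_lfunE.
by have /[!memv_ker]/eqP-> := subvsP v; rewrite linear0.
Qed.

Fact ker_diter_val n i j (v : ker_obj i) :
  vsval (diter ker_diff n i j v) = diter (ndiff X) n i j (vsval v).
Proof.
elim: n i v => [|n IHn] i v /=.
  by case: eqP => [e|_]; [subst j; rewrite !lfunE | rewrite !lfunE].
by rewrite !comp_lfunE IHn ker_diff_val.
Qed.

Fact ker_diffN i : diter ker_diff N i (i + N%:Z) = 0.
Proof. by apply/lfunP => v; apply/val_inj; rewrite /= ker_diter_val ndiffN !lfunE. Qed.

Fact ker_pos : positive (NComplex ker_diffN).
Proof.
move=> i i0; apply/eqP; rewrite dimv_eq0 -subv0; apply/subvP => v _.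
have /eqP := pos_cxP (i := i) X i0; rewrite dimv_eq0 => /eqP X0.
have : vsval v \in fullv by exact: memvf.
by rewrite X0 memv0 => /eqP v0; rewrite memv0; apply/eqP/val_inj.
Qed.

Definition ker_cx : posNcomplex k N := PosNComplex ker_pos.

Definition ker_incl_fun i : 'Hom(ker_obj i, X i) :=
  linfun (vsval : subvs_of (lker (f i)) -> X i).

Fact ker_incl_val i (v : ker_obj i) : ker_incl_fun i v = vsval v.
Proof. by rewrite lfunE. Qed.

Fact ker_incl_comm i :
  (ker_incl_fun (i + 1)%R \o ker_diff i = ndiff X i \o ker_incl_fun i)%VF.
Proof. by apply/lfunP => v; rewrite !comp_lfunE !ker_incl_val ker_diff_val. Qed.

Definition ker_incl : mor ker_cx X :=
  @Mor k N ker_cx X ker_incl_fun ker_incl_comm.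

Lemma ker_incl_inj i : lker (ker_incl i) = 0%VS.
Proof.
apply/eqP; rewrite -subv0; apply/subvP => v; rewrite memv_ker ker_incl_val memv0 => /eqP v0.
by apply/eqP/val_inj.
Qed.

Lemma ker_incl_img i : limg (ker_incl i) = lker (f i).
Proof.
apply/vspaceP => v; apply/memv_imgP/idP => [[u _ ->]|vK].
  by rewrite ker_incl_val subvsP.
by exists (vsproj _ v); rewrite ?memvf // ker_incl_val vsprojK.
Qed.

End Kernel.

(* Enough projectives: the cover F(X) = \bigoplus_i M_i^{N-1} \otimes X_i has   *)
(* in degree j the basis of pairs (i, t) with j - N < i <= j and t < dim X_i,   *)
(* and its differential sends (i, t) to (i, t).                                *)
Section Cover.
Variables (k : fieldType) (N : nat) (X : posNcomplex k N).

Definition cover_gen (j : int) : finType :=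
  {s : 'I_N & 'I_(\dim {: X (j - s%:Z)})}.
Definition gen_deg j (x : cover_gen j) : int := j - (tag x : nat)%:Z.
Definition gen_num j (x : cover_gen j) : nat := tagged x.
Definition gen_is i t j (x : cover_gen j) := (gen_deg x == i) && (gen_num x == t).

Definition cover_obj j : vectType k := {ffun cover_gen j -> k^o}.

Definition cover_coef j (f : cover_obj j) (i : int) (t : nat) : k^o :=
  \sum_(x : cover_gen j | gen_is i t x) f x.

Lemma gen_inj j (x y : cover_gen j) :
  gen_is (gen_deg x) (gen_num x) y -> y = x.
Proof.
case: x y => [s t] [s' t'] /andP[/eqP]; rewrite /gen_deg /gen_num /= => es.
have {}es : s' = s by apply: val_inj => /=; lia.
by subst s' => /eqP/val_inj->.
Qed.

Lemma gen_isE j (x y : cover_gen j) :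
  gen_is (gen_deg x) (gen_num x) y = (y == x).
Proof. by apply/idP/eqP => [/gen_inj|->] //; rewrite /gen_is !eqxx. Qed.

Lemma gen_exists j i t : j - N%:Z < i <= j -> (t < \dim {: X i})%N ->
  exists x : cover_gen j, gen_is i t x.
Proof.
move=> ij tX; have sN : (`|(j - i)%R|%N < N)%N by lia.
have ei : i = j - `|(j - i)%R|%N%:Z by lia.
have {}tX : (t < \dim {: X (j - `|(j - i)%R|%N%:Z)%R})%N by rewrite -ei.
exists (Tagged (fun s : 'I_N => 'I_(\dim {: X (j - s%:Z)}))
          (Ordinal tX : 'I_(\dim {: X (j - (Ordinal sN : 'I_N)%:Z)}))).
by rewrite /gen_is /gen_deg /gen_num /= -ei !eqxx.
Qed.

Lemma gen_bound j (x : cover_gen j) :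
  j - N%:Z < gen_deg x <= j /\ (gen_num x < \dim {: X (gen_deg x)})%N.
Proof.
by split; [case: x => -[s sN] t; rewrite /gen_deg /=; lia | exact: ltn_ord].
Qed.

Lemma cover_coefE j (f : cover_obj j) x : cover_coef f (gen_deg x) (gen_num x) = f x.
Proof. by rewrite /cover_coef (big_pred1 x) // => y; rewrite gen_isE. Qed.

Lemma cover_coef_out j (f : cover_obj j) i t :
  ~~ (j - N%:Z < i <= j) -> cover_coef f i t = 0.
Proof.
move=> nij; rewrite /cover_coef big_pred0 // => x; apply/negP => /andP[/eqP ei _].
by move: nij; rewrite -ei; have [-> _] := gen_bound x.
Qed.

Lemma cover_coefP j a (f g : cover_obj j) i t :
  cover_coef (a *: f + g) i t = a * cover_coef f i t + cover_coef g i t.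
Proof.
rewrite /cover_coef mulr_sumr -big_split /=.
by apply: eq_bigr => x _; rewrite !ffunE.
Qed.

Definition cover_shift j j' (f : cover_obj j) : cover_obj j' :=
  [ffun x => cover_coef f (gen_deg x) (gen_num x)].

Fact cover_shift_linear j j' : linear (@cover_shift j j').
Proof. by move=> a f g; apply/ffunP => x; rewrite !ffunE cover_coefP. Qed.
HB.instance Definition _ j j' :=
  GRing.isLinear.Build k (cover_obj j) (cover_obj j') _ (@cover_shift j j')
    (@cover_shift_linear j j').

Definition cover_diff j : 'Hom(cover_obj j, cover_obj (j + 1)) :=
  linfun (@cover_shift j (j + 1)).

Lemma cover_diffE j (f : cover_obj j) : cover_diff j f = cover_shift (j + 1) f.
Proof. exact: lfunE. Qed.

Lemma cover_shift_coef j j' (f : cover_obj j) i t :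
  j <= j' -> j' - N%:Z < i -> (t < \dim {: X i})%N ->
  cover_coef (cover_shift j' f) i t = cover_coef f i t.
Proof.
move=> jj' ji tX; have [ij'|ij'] := leP i j'.
  have [|x /andP[/eqP <- /eqP <-]] := @gen_exists j' i t _ tX; first by lia.
  by rewrite cover_coefE ffunE.
by rewrite !cover_coef_out //; lia.
Qed.

Lemma cover_diter n j j' (f : cover_obj j) :
  j' = j + n%:Z -> diter cover_diff n j j' f = cover_shift j' f.
Proof.
elim: n j f => [|n IHn] j f ej.
  have {}ej : j' = j by lia.
  subst j'; rewrite diter0 lfunE /=; apply/ffunP => x.
  by rewrite ffunE cover_coefE.
rewrite /= comp_lfunE IHn; last by lia.
rewrite lfunE /=; apply/ffunP => x; rewrite !ffunE.
by have [xb xd] := gen_bound x; apply: cover_shift_coef => //; lia.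
Qed.

Fact cover_diffN j : diter cover_diff N j (j + N%:Z) = 0.
Proof.
apply/lfunP => f; rewrite cover_diter // lfunE /=; apply/ffunP => x.
by rewrite !ffunE cover_coef_out //; have [xb _] := gen_bound x; lia.
Qed.

Fact cover_pos : positive (NComplex cover_diffN).
Proof.
move=> j j0; apply/eqP; rewrite dimv_eq0 -subv0; apply/subvP => f _.
rewrite memv0; apply/eqP/ffunP => x; have [xb xd] := gen_bound x.
by have := pos_cxP (i := gen_deg x) X; lia.
Qed.

Definition cover : posNcomplex k N := PosNComplex cover_pos.

Definition cover_delta i t j : cover_obj j := [ffun x => (gen_is i t x)%:R].

Lemma cover_delta_coef i t j : j - N%:Z < i <= j -> (t < \dim {: X i})%N ->
  cover_coef (cover_delta i t j) i t = 1.
Proof.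
move=> ij tX; have [x xi] := gen_exists ij tX.
by have /andP[/eqP <- /eqP <-] := xi; rewrite cover_coefE ffunE gen_isE eqxx.
Qed.

Lemma cover_delta_diter i t n j : j = i + n%:Z -> (0 < N)%N -> (t < \dim {: X i})%N ->
  diter cover_diff n i j (cover_delta i t i) = cover_delta i t j.
Proof.
move=> ej N0 tX; rewrite cover_diter //; apply/ffunP => x; rewrite !ffunE.
have [/andP[/eqP -> /eqP ->]|nx] := boolP (gen_is i t x).
  by rewrite cover_delta_coef //; lia.
rewrite /cover_coef big1 // => y /andP[/eqP ey /eqP ty]; rewrite ffunE.
by rewrite /gen_is ey ty; rewrite /gen_is in nx; rewrite (negPf nx).
Qed.

Lemma cover_sum j (f : cover_obj j) :
  f = \sum_(x : cover_gen j) f x *: cover_delta (gen_deg x) (gen_num x) j.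
Proof.
apply/ffunP => y; rewrite sum_ffunE (bigD1 y) //= big1 ?addr0 => [|x xy].
  by rewrite !ffunE gen_isE eqxx [_ *: _]mulr1.
by rewrite !ffunE gen_isE eq_sym (negPf xy) [_ *: _]mulr0.
Qed.

Section Lift.
Variables (B : posNcomplex k N) (a : forall i, nat -> B i).

Definition cover_phi i t j : B j := diter (ndiff B) `|(j - i)%R|%N i j (a i t).

Definition cover_map_fun j (f : cover_obj j) : B j :=
  \sum_(x : cover_gen j) f x *: cover_phi (gen_deg x) (gen_num x) j.

Fact cover_map_linear j : linear (@cover_map_fun j).
Proof.
move=> c f g; rewrite /cover_map_fun scaler_sumr -big_split /=.
by apply: eq_bigr => x _; rewrite !ffunE scalerDl scalerA.
Qed.
HB.instance Definition _ j :=
  GRing.isLinear.Build k (cover_obj j) (B j) _ (@cover_map_fun j) (@cover_map_linear j).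

Fact cover_map_comm j :
  (linfun (@cover_map_fun (j + 1)%R) \o cover_diff j =
   ndiff B j \o linfun (@cover_map_fun j))%VF.
Proof.
apply/lfunP => f; rewrite !comp_lfunE cover_diffE !lfunE /= /cover_map_fun.
rewrite linear_sum /=.
under eq_bigr => x _ do rewrite ffunE /cover_coef scaler_suml.
rewrite (exchange_big_dep xpredT) //=; apply: eq_bigr => y _; rewrite linearZ /=.
have [yb yd] := gen_bound y.
have -> : ndiff B j (cover_phi (gen_deg y) (gen_num y) j) =
    cover_phi (gen_deg y) (gen_num y) (j + 1).
  rewrite /cover_phi; set n := `|(j - _)%R|%N.
  have -> : `|(j + 1 - gen_deg y)%R|%N = n.+1 by rewrite /n; lia.
  by rewrite diterSr ?comp_lfunE // /n; lia.
have [yj|yj] := leP (gen_deg y) (j + 1 - N%:Z).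
  rewrite big_pred0 => [|x]; last first.
    apply/negP => /andP[/eqP yx _]; have [xb _] := gen_bound x.
    by move: xb; rewrite -yx; lia.
  rewrite /cover_phi (diter_over (n := N)) ?lfunE ?scaler0 //; [exact: ndiffN | lia].
have [|x xy] := @gen_exists (j + 1) (gen_deg y) (gen_num y) _ yd; first by lia.
have /andP[/eqP xd /eqP xn] := xy; rewrite (big_pred1 x) ?xd ?xn // => z.
by rewrite /= -(gen_isE x z) /gen_is xd xn ![gen_deg y == _]eq_sym ![gen_num y == _]eq_sym.
Qed.

Definition cover_map : mor cover B :=
  @Mor k N cover B (fun j => linfun (@cover_map_fun j)) cover_map_comm.

End Lift.

Lemma cover_map_eq (B : posNcomplex k N) (a : forall i, nat -> B i) (h : mor cover B) :
  (forall i t, (t < \dim {: X i})%N -> a i t = h i (cover_delta i t i)) ->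
  cover_map a = h.
Proof.
move=> ah; apply: morP => j; apply/lfunP => f; rewrite lfunE /= /cover_map_fun.
rewrite [in RHS](cover_sum f) linear_sum; apply: eq_bigr => x _; rewrite linearZ /=.
have [xb xd] := gen_bound x; congr (_ *: _); rewrite /cover_phi ah //.
have /lfunP/(_ (cover_delta (gen_deg x) (gen_num x) (gen_deg x))) :=
  mor_diter h `|(j - gen_deg x)%R|%N (gen_deg x) j.
rewrite !comp_lfunE => <-; congr (h j _).
by apply: cover_delta_diter => //; [lia | case: x {xb xd} => -[s sN] _; lia].
Qed.

Lemma cover_map_comp (A B : posNcomplex k N) (g : mor A B) (a : forall i, nat -> A i) :
  mor_comp g (cover_map a) = cover_map (fun i t => g i (a i t)).
Proof.
apply: morP => j; apply/lfunP => f; rewrite comp_lfunE !lfunE /= /cover_map_fun.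
rewrite linear_sum; apply: eq_bigr => x _; rewrite linearZ /= /cover_phi.
congr (_ *: _).
by have /lfunP/(_ (a (gen_deg x) (gen_num x))) := mor_diter g `|(j - gen_deg x)%R|%N (gen_deg x) j;
  rewrite !comp_lfunE.
Qed.

Lemma cover_projective : projective cover.
Proof.
move=> A B g h gsurj.
have lift i t : exists a : A i, g i a = h i (cover_delta i t i).
  have : h i (cover_delta i t i) \in limg (g i) by rewrite gsurj memvf.
  by move=> /memv_imgP[a _ ->]; exists a.
exists (cover_map (fun i t => sval (cid (lift i t)))).
by rewrite cover_map_comp; apply: cover_map_eq => i t _; case: cid.
Qed.

Definition cover_proj : mor cover X :=
  cover_map (fun i t => (vbasis {: X i})`_t).

Lemma cover_proj_surj : surjective_mor cover_proj.
Proof.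
move=> j; have [N0|N0] := posnP N.
  have : diter (ndiff X) 0 j j = 0 by apply: (@diter_over k X (ndiff X) N 0 j j (ndiffN X)); rewrite N0.
  rewrite diter0 => /lfunP X0; apply/vspaceP => v.
  by have := X0 v; rewrite !lfunE /= => ->; rewrite !mem0v.
apply/eqP; rewrite eqEsubv subvf -(span_basis (vbasisP {: X j})).
apply/span_subvP => v /(nthP 0)[t]; rewrite size_tuple => tX <- {v}.
apply/memv_imgP; exists (cover_delta j t j : cover j); first exact: memvf.
have [|x xjt] := @gen_exists j j t _ tX; first by lia.
have /andP[/eqP xj /eqP xt] := xjt.
rewrite lfunE /= /cover_map_fun (bigD1 x) //= big1 ?addr0 => [|y yx].
  by rewrite ffunE xjt scale1r xj xt /cover_phi subrr absz0 diter0 lfunE.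
by rewrite ffunE -[in gen_is j]xj -[in gen_is _ t]xt gen_isE (negPf yx) scale0r.
Qed.

End Cover.

Section Existence.
Variables (k : fieldType) (N : nat) (X : posNcomplex k N).

(* Iterated syzygies of X for the covers above.                                *)
Fixpoint syzygy (n : nat) : posNcomplex k N :=
  if n is n'.+1 then ker_cx (cover_proj (syzygy n')) else X.

Definition syzygy_diff n : mor (cover (syzygy n.+1)) (cover (syzygy n)) :=
  mor_comp (ker_incl (cover_proj (syzygy n))) (cover_proj (syzygy n.+1)).

Fact syzygy_img n i : limg (syzygy_diff n i) = lker (cover_proj (syzygy n) i).
Proof. by rewrite -ker_incl_img limg_comp cover_proj_surj. Qed.

Fact syzygy_exactS n : exact_at (syzygy_diff n.+1) (syzygy_diff n).
Proof.
move=> i; rewrite syzygy_img; apply/vspaceP => v.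
rewrite !memv_ker comp_lfunE -!memv_ker.
rewrite (_ : (_ \in lker (ker_incl _ i)) = (cover_proj (syzygy n.+1) i v \in 0%VS)).
  by rewrite memv0 memv_ker.
by rewrite ker_incl_inj.
Qed.

(* The standard resolution; Ext does not depend on this choice, up to         *)
(* isomorphism, by the comparison theorem.                                     *)
Definition std_projres : projres X :=
  ProjRes (fun n => @cover_projective k N (syzygy n)) (@cover_proj_surj k N X)
    (syzygy_img 0) syzygy_exactS.

End Existence.

(* Ext^n(X, Y) in L_N^{>=0}, as an lmodType over k                             *)
Definition Ext (k : fieldType) (N n : nat) (X Y : posNcomplex k N) : lmodType k :=
  ext_of_res (std_projres X) n Y.

Lemma amplitude_lt (N a : nat) : (0 < a < N)%N -> (a - 1 < N)%N.
Proof. by lia. Qed.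

Lemma coamplitude_lt (N a : nat) : (0 < a < N)%N -> (N - a - 1 < N)%N.
Proof. by lia. Qed.

(* Main.v *)
(** Let [P_i = M_i^(N-1)].  A morphism from [P_i] to [Y] is the choice of an element
    of [Y_i], so for i >= 0 the complex [P_i] is projective.  Gluing the short exact
    sequences [0 -> M_(i+l+1)^(N-l-2) -> P_i -> M_i^l -> 0] gives the projective
    resolution [... -> P_(i+N+l+1) -> P_(i+N) -> P_(i+l+1) -> P_i] of [M_i^l];
    applying Hom(-, M) turns it into the sequence of vector spaces
    [M_i -> M_(i+l+1) -> M_(i+N) -> M_(i+N+l+1) -> ...] with maps alternately
    [d^(l+1)] and [d^(N-l-1)], whose cohomology is amplitude cohomology.  The
    comparison theorem for projective resolutions transports the result to the
    resolution that defines Ext.  In degree 0 the incoming map of amplitude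
    cohomology vanishes because it starts in a negative degree of [M]. *)

Require Import Defs.
From HB Require Import structures.
From mathcomp Require Import all_boot all_order all_algebra.
From mathcomp Require Import zify.

Set Implicit Arguments.
Unset Strict Implicit.
Unset Printing Implicit Defensive.

Import Order.TTheory GRing.Theory Num.Theory.

Local Open Scope ring_scope.

(** * Maps induced on homology *)

Lemma lmod_iso_of (k : fieldType) (A B : lmodType k) (h : A -> B) :
  linear h -> bijective h -> lmod_iso A B.
Proof.
move=> hlin hbij.
pose H : {linear A -> B} := HB.pack h (GRing.isLinear.Build k A B *:%R h hlin).
by exists H.
Qed.

Lemma lmod_iso_trans (k : fieldType) (A B C : lmodType k) :
  lmod_iso A B -> lmod_iso B C -> lmod_iso A C.
Proof.
move=> [f fb] [g gb]; apply: (@lmod_iso_of k A C (g \o f)); last exact: bij_comp.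
by move=> c x y; rewrite /= !linearP.
Qed.

Section HomologyMap.
Variables (k : fieldType) (U V W U' V' W' : lmodType k).
Variables (f : {linear U -> V}) (g : {linear V -> W}).
Variables (f' : {linear U' -> V'}) (g' : {linear V' -> W'}).
Variable phi : {linear V -> V'}.
Hypothesis phi_ker : forall v, g v = 0 -> g' (phi v) = 0.
Hypothesis phi_im : forall v, (exists u, f u = v) -> exists u', f' u' = phi v.

Fact cycle_map_subproof (z : Defs.cycle g) : phi (val z) \in lin_ker g'.
Proof. by apply/eqP/phi_ker/eqP; exact: (valP z). Qed.

Definition cycle_map (z : Defs.cycle g) : Defs.cycle g' := Cycle (cycle_map_subproof z).

Definition homology_map (x : homology f g) : homology f' g' :=
  homology_class f' (cycle_map (repr (x : Quotient.quot (lin_im f (g := g))))).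

(** Independence of the representative: [repr] returns a cycle that differs from [z] by a boundary,
    and [phi_im] sends that boundary to a boundary. *)
Lemma homology_mapE z :
  homology_map (homology_class f z) = homology_class f' (cycle_map z).
Proof.
apply/homology_classP; rewrite /= -linearB; apply: phi_im.
by apply/homology_classP; rewrite /homology_class reprK.
Qed.

Lemma homology_map_linear : linear homology_map.
Proof.
move=> c x y; have [z ->] := homology_ind x; have [t ->] := homology_ind y.
have -> : c *: homology_class f z + homology_class f t = homology_class f (c *: z + t).
  by rewrite homology_classD homology_classZ.
have -> : homology_map (homology_class f (c *: z + t)) =
    homology_class f' (c *: cycle_map z + cycle_map t).
  rewrite homology_mapE; congr homology_class.
  by apply/val_inj; rewrite /= linearP.
by rewrite homology_classD homology_classZ !homology_mapE.
Qed.

End HomologyMap.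

(** The induced maps are mutually inverse because on cycles both composites differ from the identity
    by boundaries. The conditions concern kernels and images only, with no map between [U] and [U'];
    this suits amplitude cohomology in degree 0, where the sources of the incoming maps are
    unrelated. *)
Lemma homology_iso (k : fieldType) (U V W U' V' W' : lmodType k)
    (f : {linear U -> V}) (g : {linear V -> W})
    (f' : {linear U' -> V'}) (g' : {linear V' -> W'})
    (phi : {linear V -> V'}) (psi : {linear V' -> V}) :
  (forall v, g v = 0 -> g' (phi v) = 0) ->
  (forall v, (exists u, f u = v) -> exists u', f' u' = phi v) ->
  (forall v, g' v = 0 -> g (psi v) = 0) ->
  (forall v, (exists u, f' u = v) -> exists u', f u' = psi v) ->
  (forall v, g v = 0 -> exists u, f u = psi (phi v) - v) ->
  (forall v, g' v = 0 -> exists u, f' u = phi (psi v) - v) ->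
  lmod_iso (homology f g) (homology f' g').
Proof.
move=> phi_ker phi_im psi_ker psi_im phiK psiK.
apply: (lmod_iso_of (homology_map_linear phi_ker phi_im)).
exists (homology_map f psi_ker) => x; have [z ->] := homology_ind x;
  rewrite !homology_mapE //; apply/homology_classP => /=.
- by apply: phiK; apply/eqP; exact: (valP z).
- by apply: psiK; apply/eqP; exact: (valP z).
Qed.

(** * Composition of morphisms of N-complexes *)

Section MorCompTheory.
Variables (k : fieldType) (N : nat).
Implicit Types X Y Z T : Ncomplex k N.

Lemma mor_compA X Y Z T (h : mor Z T) (g : mor Y Z) (f : mor X Y) :
  mor_comp h (mor_comp g f) = mor_comp (mor_comp h g) f.
Proof. by apply: morP => i /=; rewrite comp_lfunA. Qed.

Lemma mor_compDl X Y Z (g h : mor Y Z) (f : mor X Y) :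
  mor_comp (g + h) f = mor_comp g f + mor_comp h f.
Proof. by apply: morP => i /=; rewrite comp_lfunDl. Qed.

Lemma mor_compBl X Y Z (g h : mor Y Z) (f : mor X Y) :
  mor_comp (g - h) f = mor_comp g f - mor_comp h f.
Proof. by apply: morP => i /=; rewrite comp_lfunDl comp_lfunNl. Qed.

Lemma mor_compDr X Y Z (h : mor Y Z) (f g : mor X Y) :
  mor_comp h (f + g) = mor_comp h f + mor_comp h g.
Proof. by apply: morP => i /=; rewrite comp_lfunDr. Qed.

Lemma mor_compBr X Y Z (h : mor Y Z) (f g : mor X Y) :
  mor_comp h (f - g) = mor_comp h f - mor_comp h g.
Proof. by apply: morP => i /=; rewrite comp_lfunDr comp_lfunNr. Qed.

Lemma mor_comp0l X Y Z (f : mor X Y) : mor_comp (0 : mor Y Z) f = 0.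
Proof. by apply: morP => i /=; rewrite comp_lfun0l. Qed.

Lemma mor_comp0r X Y Z (g : mor Y Z) : mor_comp g (0 : mor X Y) = 0.
Proof. by apply: morP => i /=; rewrite comp_lfun0r. Qed.

Fact mor_id_comm X i : (\1 \o ndiff X i = ndiff X i \o \1)%VF.
Proof. by rewrite comp_lfun1l comp_lfun1r. Qed.
Definition mor_id X : mor X X := @Mor k N X X (fun=> \1%VF) (@mor_id_comm X).

Lemma mor_comp1r X Y (f : mor X Y) : mor_comp f (mor_id X) = f.
Proof. by apply: morP => i /=; rewrite comp_lfun1r. Qed.

Lemma mor_comp1l X Y (f : mor X Y) : mor_comp (mor_id Y) f = f.
Proof. by apply: morP => i /=; rewrite comp_lfun1l. Qed.

End MorCompTheory.

(** * Kernels and lifting along exact pairs *)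

Section Lifting.
Variables (k : fieldType) (N : nat).
Implicit Types X Y Z P : posNcomplex k N.

(** Universal property of the kernel: each [h i] takes values in [lker (g i)], so [vsproj] leaves
    these values unchanged. *)
Lemma ker_factor X Y Z (g : mor Y Z) (h : mor X Y) :
  mor_comp g h = 0 -> exists h' : mor X (ker_cx g), mor_comp (ker_incl g) h' = h.
Proof.
move=> gh0.
pose hf i : 'Hom(X i, ker_cx g i) := linfun (vsproj (lker (g i)) \o h i).
have hfE i x : vsval (hf i x) = h i x.
  rewrite lfunE /= vsprojK // memv_ker -comp_lfunE.
  by have -> : (g i \o h i)%VF = (mor_comp g h) i by []; rewrite gh0 lfunE.
have hcomm i : (hf (i + 1) \o ndiff X i = ndiff (ker_cx g) i \o hf i)%VF.
  apply/lfunP => x; apply/val_inj; rewrite !comp_lfunE /= ker_diff_val.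
  by rewrite [LHS]hfE [in RHS]hfE -!comp_lfunE mor_comm.
exists (@Mor k N X (ker_cx g) hf hcomm); apply: morP => i; apply/lfunP => x.
by rewrite comp_lfunE ker_incl_val hfE.
Qed.

Lemma exact_comp0 X Y Z (f : mor X Y) (g : mor Y Z) :
  exact_at f g -> mor_comp g f = 0.
Proof.
move=> fg; apply: morP => i; apply/lfunP => x; rewrite comp_lfunE lfunE /=.
by apply/eqP; rewrite -memv_ker -fg memv_img ?memvf.
Qed.

(** Both [f] and [h] factor through [ker_cx g]; exactness makes the factor of [f] surjective, so
    projectivity of [P] applies. *)
Lemma projective_exact P X Y Z (f : mor X Y) (g : mor Y Z) (h : mor P Y) :
  projective P -> exact_at f g -> mor_comp g h = 0 ->
  exists h' : mor P X, mor_comp f h' = h.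
Proof.
move=> Pproj fg gh0.
have [f' f'E] := ker_factor (exact_comp0 fg).
have [h' h'E] := ker_factor gh0.
have f'surj : surjective_mor f'.
  move=> i; apply/vspaceP => y; rewrite memvf.
  have : vsval y \in limg (f i) by rewrite fg subvsP.
  case/memv_imgP => x _ xy; apply/memv_imgP; exists x; first exact: memvf.
  by apply/val_inj; rewrite /= xy -f'E comp_lfunE ker_incl_val.
have [u uE] := Pproj _ _ _ h' f'surj; exists u.
by rewrite -f'E -mor_compA uE.
Qed.

End Lifting.

(** * The comparison theorem for projective resolutions *)

Section Comparison.
Variables (k : fieldType) (N : nat) (X : posNcomplex k N).
Implicit Types P Q R : projres X.

(* A morphism P_n -> Q_n which is the degree n part of a chain map up to       *)
(* degree n over the identity of X.                                            *)
Fixpoint over_id P Q n : mor (pr_obj P n) (pr_obj Q n) -> Prop :=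
  match n with
  | 0 => fun f => mor_comp (pr_aug Q) f = pr_aug P
  | m.+1 => fun f => exists2 f' : mor (pr_obj P m) (pr_obj Q m),
      over_id f' & mor_comp (pr_diff Q m) f = mor_comp f' (pr_diff P m)
  end.

Lemma pr_aug_diff P : mor_comp (pr_aug P) (pr_diff P 0) = 0.
Proof. exact/exact_comp0/pr_exact0. Qed.

Lemma pr_diff_diff P n : mor_comp (pr_diff P n) (pr_diff P n.+1) = 0.
Proof. exact/exact_comp0/pr_exactS. Qed.

Lemma over_id_id P n : over_id (mor_id (pr_obj P n)).
Proof.
elim: n => [|n IHn] /=; first exact: mor_comp1r.
by exists (mor_id (pr_obj P n)); rewrite ?mor_comp1r ?mor_comp1l.
Qed.

Lemma over_id_comp P Q R n (g : mor (pr_obj Q n) (pr_obj R n))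
    (f : mor (pr_obj P n) (pr_obj Q n)) :
  over_id g -> over_id f -> over_id (mor_comp g f).
Proof.
elim: n g f => [|n IHn] g f /=; first by move=> gE fE; rewrite mor_compA gE.
move=> [g' g'o gg'] [f' f'o ff']; exists (mor_comp g' f'); first exact: IHn.
by rewrite mor_compA gg' -!mor_compA ff'.
Qed.

(** One more degree of the chain map: [f] after [pr_diff P n] is killed by the differential of [Q],
    or by its augmentation when [n = 0], hence lifts by exactness. *)
Lemma over_id_lift P Q n (f : mor (pr_obj P n) (pr_obj Q n)) : over_id f ->
  exists f', mor_comp (pr_diff Q n) f' = mor_comp f (pr_diff P n).
Proof.
case: n f => [|n] f /=.
  move=> fE; apply: projective_exact (pr_exact0 Q) _; first exact: pr_projective.
  by rewrite mor_compA fE pr_aug_diff.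
move=> [f' _ ff']; apply: projective_exact (pr_exactS Q n) _; first exact: pr_projective.
by rewrite mor_compA ff' -mor_compA pr_diff_diff mor_comp0r.
Qed.

Lemma over_id_exists P Q n : exists f : mor (pr_obj P n) (pr_obj Q n), over_id f.
Proof.
elim: n => [|n [f fo]]; first by apply: pr_projective; exact: pr_aug_surj.
by have [f' f'E] := over_id_lift fo; exists f', f.
Qed.

(** Only the degree [n] part of a homotopy: [s] and [r] are chosen afresh in each degree, which is
    all that cohomology in degree [n] sees. *)
Definition null_homotopic P Q n : mor (pr_obj P n) (pr_obj Q n) -> Prop :=
  match n with
  | 0 => fun h => exists s, h = mor_comp (pr_diff Q 0) s
  | m.+1 => fun h => exists s r,
      h = mor_comp (pr_diff Q m.+1) s + mor_comp r (pr_diff P m)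
  end.

Lemma over_id_homotopic P Q n (f g : mor (pr_obj P n) (pr_obj Q n)) :
  over_id f -> over_id g -> null_homotopic (f - g).
Proof.
elim: n f g => [|n IHn] f g /=.
  move=> fE gE; have [|s sE] := projective_exact (h := f - g)
    (@pr_projective _ _ _ P 0) (pr_exact0 Q); last by exists s.
  by rewrite mor_compBr fE gE subrr.
move=> [f' f'o ff'] [g' g'o gg'].
(* Composed with [pr_diff P n], the homotopy for [f' - g'] loses its second term since [d d = 0];
   its [s] becomes the new [r]. *)
have [r rE] : exists r : mor (pr_obj P n) (pr_obj Q n.+1),
    mor_comp (f' - g') (pr_diff P n) =
    mor_comp (pr_diff Q n) (mor_comp r (pr_diff P n)).
  have := IHn _ _ f'o g'o; case: (n) f' g' {ff' gg' f'o g'o IHn f g} => [|m] f' g' /=.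
    by move=> [s ->]; exists s; rewrite mor_compA.
  move=> [s [r ->]]; exists s.
  by rewrite mor_compDl -[mor_comp (mor_comp r _) _]mor_compA pr_diff_diff
    mor_comp0r addr0 mor_compA.
(* By the choice of [r], the remainder [f - g - r d] is killed by the differential of [Q], so it
   lifts to [s]. *)
have [|s sE] := projective_exact (h := f - g - mor_comp r (pr_diff P n))
    (@pr_projective _ _ _ P n.+1) (pr_exactS Q n); last by exists s, r; rewrite sE subrK.
by rewrite !mor_compBr ff' gg' -rE mor_compBl subrr.
Qed.

Definition coboundary P n Y : mor (pr_obj P n) Y -> Prop :=
  match n with
  | 0 => fun c => c = 0
  | m.+1 => fun c => exists u, mor_comp u (pr_diff P m) = c
  end.

(** Gives degree 0 and positive degrees one common shape; the case distinction survives only in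
    [coboundary]. *)
Lemma ext_of_resE P n (Y : posNcomplex k N) :
  exists (U : lmodType k) (f : {linear U -> mor (pr_obj P n) Y}),
    ext_of_res P n Y = homology f (precomp (pr_diff P n)) /\
    (forall c, (exists u, f u = c) <-> coboundary c).
Proof.
case: n => [|n] /=; last by exists _, (precomp (pr_diff P n)).
exists _, (\0 : {linear mor (pr_obj P 0) Y -> mor (pr_obj P 0) Y}); split=> // c.
by split=> [[u <-]|->] //; exists 0.
Qed.

(** Lifts of the identity of [X] in both directions compose to lifts homotopic to the identity, so
    precomposition with them gives inverse maps on cohomology. *)
Lemma ext_of_res_iso P Q n (Y : posNcomplex k N) :
  lmod_iso (ext_of_res P n Y) (ext_of_res Q n Y).
Proof.
have [U [f [-> fE]]] := ext_of_resE P n Y.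
have [V [g [-> gE]]] := ext_of_resE Q n Y.
have [F Fo] := over_id_exists Q P n; have [G Go] := over_id_exists P Q n.
have cocycle_comp P1 Q1 (H : mor (pr_obj P1 n) (pr_obj Q1 n)) c : over_id H ->
    mor_comp c (pr_diff Q1 n) = 0 :> mor _ Y ->
    mor_comp (mor_comp c H) (pr_diff P1 n) = 0.
  move=> /over_id_lift[H' H'E] c0.
  by rewrite -mor_compA -H'E mor_compA c0 mor_comp0l.
have coboundary_comp P1 Q1 (H : mor (pr_obj P1 n) (pr_obj Q1 n)) (c : mor _ Y) :
    over_id H -> coboundary c -> coboundary (mor_comp c H).
  case: (n) H c => [|m] H c /=; first by move=> _ ->; rewrite mor_comp0l.
  move=> [H' _ H'E] [u <-]; exists (mor_comp u H').
  by rewrite -!mor_compA H'E.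
(* With [H - 1 = d s + r d], the difference is [c d s + c r d], whose first term vanishes on
   cocycles. *)
have homotopy P1 (H : mor (pr_obj P1 n) (pr_obj P1 n)) (c : mor _ Y) : over_id H ->
    mor_comp c (pr_diff P1 n) = 0 -> coboundary (mor_comp c H - c).
  move=> Ho c0; have := over_id_homotopic Ho (over_id_id P1 n).
  have -> : mor_comp c H - c = mor_comp c (H - mor_id _).
    by rewrite mor_compBr mor_comp1r.
  case: (n) c c0 (H - _) => [|m] c c0 h /=.
    by move=> [s ->]; rewrite mor_compA c0 mor_comp0l.
  move=> [s [r ->]]; exists (mor_comp c r).
  by rewrite mor_compDr !mor_compA c0 mor_comp0l add0r.
apply: (homology_iso (phi := precomp F) (psi := precomp G)).
- by move=> c /= c0; exact: cocycle_comp.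
- by move=> c /fE cb; apply/gE; exact: coboundary_comp.
- by move=> c /= c0; exact: cocycle_comp.
- by move=> c /gE cb; apply/fE; exact: coboundary_comp.
- move=> c /= c0; apply/fE; rewrite /precomp -mor_compA; apply: homotopy => //.
  exact: over_id_comp.
- move=> c /= c0; apply/gE; rewrite /precomp -mor_compA; apply: homotopy => //.
  exact: over_id_comp.
Qed.

End Comparison.

(** * Morphisms out of interval complexes *)

(** Rows have length 0 or 1, so the sum of the entries is the only coordinate, or 0 when there is
    none; this covers all four cases by one formula. *)
Lemma mulmx_pid_bool (k : fieldType) (b b' : bool) (x : 'rV[k]_b) :
  x *m pid_mx 1 = (\sum_t x 0 t) *: (const_mx 1 : 'rV[k]_b').
Proof.
case: b x => x; last by rewrite (thinmx0 x) mul0mx big_ord0 scale0r.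
case: b'; last by rewrite [LHS]thinmx0 [RHS]thinmx0.
by rewrite pid_mx_1 mulmx1; apply/rowP => t; rewrite big_ord1 !mxE mulr1 (ord1 t).
Qed.

Section IntervalMor.
Variables (k : fieldType) (N : nat).

Definition icoef i l j (x : interval_obj k i l j) : k := \sum_t x 0 t.

(** The basis vector in degrees of the support; elsewhere the row is empty and this is 0. *)
Definition igen i l j : interval_obj k i l j := const_mx 1.

Lemma icoefP i l j c (x y : interval_obj k i l j) :
  icoef (c *: x + y) = c * icoef x + icoef y.
Proof.
rewrite /icoef mulr_sumr -big_split /=.
by apply: eq_bigr => t _; rewrite !mxE.
Qed.

Lemma icoefZ i l j c (x : interval_obj k i l j) : icoef (c *: x) = c * icoef x.
Proof. by rewrite /icoef mulr_sumr; apply: eq_bigr => t _; rewrite !mxE. Qed.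

Lemma icoef_out i l j (x : interval_obj k i l j) : ~~ interval_supp i l j -> icoef x = 0.
Proof.
by move=> nsj; rewrite (interval_objN x nsj) /icoef big1 // => t _; rewrite mxE.
Qed.

Lemma icoef_gen i l j : interval_supp i l j -> icoef (igen i l j) = 1.
Proof.
rewrite /icoef /igen /interval_obj; case: (interval_supp i l j) => // _.
by rewrite big_ord1 mxE.
Qed.

Lemma igenE i l j (x : interval_obj k i l j) : x = icoef x *: igen i l j.
Proof.
apply/rowP => t; rewrite !mxE mulr1 /icoef.
move: x t; rewrite /interval_obj; case: (interval_supp i l j) => x t.
  by rewrite big_ord1 (ord1 t).
by case: t.
Qed.

Lemma interval_diffE i l j (x : interval_obj k i l j) :
  interval_diff k i l j x = icoef x *: igen i l (j + 1).
Proof.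
by rewrite lfunE; exact: mulmx_pid_bool.
Qed.

Section FromInterval.
Variables (i : int) (l : nat) (lN : (l < N)%N).
Let I := interval_cx k i l lN.

(** Above the interval both sides are 0. The bound [i <= j] excludes a start below it, where the
    left side is 0 but the right side may be a basis vector. *)
Lemma igen_diter n j j' : i <= j -> j' = j + n%:Z ->
  diter (ndiff I) n j j' (igen i l j) = igen i l j'.
Proof.
move=> ij; elim: n j' => [|n IHn] j' ej.
  have {}ej : j' = j by lia.
  by subst j'; rewrite diter0 lfunE.
have -> : j' = j + n%:Z + 1 by lia.
rewrite diterSr // comp_lfunE IHn // [LHS]interval_diffE.
have [sj|nsj] := boolP (interval_supp i l (j + n%:Z)).
  by rewrite icoef_gen ?scale1r.
rewrite icoef_out // scale0r; symmetry; apply: interval_objN.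
by move: nsj; rewrite /interval_supp; lia.
Qed.

Variable Y : Ncomplex k N.

(** The complex is generated in degree [i]: iterated differentials of [igen i l i] give the basis
    vectors of all degrees in the support. *)
Lemma interval_mor_eq (f g : mor I Y) : f i (igen i l i) = g i (igen i l i) -> f = g.
Proof.
move=> fg; apply: morP => j; apply/lfunP => x.
have [sj|nsj] := boolP (interval_supp i l j); last first.
  by rewrite (interval_objN x nsj) !linear0.
have [n ej] : exists n : nat, j = i + n%:Z.
  by exists `|(j - i)%R|%N; move: sj; rewrite /interval_supp; lia.
rewrite (igenE x) !linearZ /= -(igen_diter (lexx i) ej); congr (_ *: _).
have /lfunP/(_ (igen i l i)) := mor_diter f n i j.
have /lfunP/(_ (igen i l i)) := mor_diter g n i j.
by rewrite !comp_lfunE fg => -> ->.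
Qed.

Variables (v : Y i) (v0 : diter (ndiff Y) l.+1 i (i + l.+1%:Z) v = 0).

(** The morphism sending the generator to [v]. For [j < i], where the absolute value is not [j - i],
    [icoef x] is 0. *)
Definition interval_mor_fun j (x : interval_obj k i l j) : Y j :=
  icoef x *: diter (ndiff Y) `|(j - i)%R|%N i j v.

Fact interval_mor_linear j : linear (@interval_mor_fun j).
Proof. by move=> c x y; rewrite /interval_mor_fun icoefP scalerDl scalerA. Qed.
HB.instance Definition _ j := GRing.isLinear.Build k (interval_obj k i l j) (Y j) _
  (@interval_mor_fun j) (@interval_mor_linear j).

Fact interval_mor_comm j :
  (linfun (@interval_mor_fun (j + 1)%R) \o ndiff I j =
   ndiff Y j \o linfun (@interval_mor_fun j))%VF.
Proof.
apply/lfunP => x; rewrite !comp_lfunE [ndiff I j x]interval_diffE.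
have [sj|nsj] := boolP (interval_supp i l j); last first.
  by rewrite (interval_objN x nsj) icoef_out // scale0r !linear0.
rewrite !lfunE /= /interval_mor_fun linearZ icoefZ -scalerA; congr (_ *: _).
move: sj; rewrite /interval_supp => sj; set n := `|(j - i)%R|%N.
have -> : `|(j + 1 - i)%R|%N = n.+1 by rewrite /n; lia.
have step : diter (ndiff Y) n.+1 i (j + 1) v = ndiff Y j (diter (ndiff Y) n i j v).
  by rewrite diterSr ?comp_lfunE // /n; lia.
rewrite -[RHS]step.
have [sj1|nsj1] := boolP (interval_supp i l (j + 1)).
  by rewrite icoef_gen ?scale1r.
(* Here [j] is the top degree [i + l]; the differential leaves the interval, and [v0] kills the
   other side. *)
have -> : n = l by move: nsj1; rewrite /interval_supp /n; lia.
have -> : j + 1 = i + l.+1%:Z by move: nsj1; rewrite /interval_supp; lia.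
by rewrite v0 scaler0.
Qed.

Definition interval_mor : mor I Y :=
  @Mor k N I Y (fun j => linfun (@interval_mor_fun j)) interval_mor_comm.

Lemma interval_morE j (x : interval_obj k i l j) :
  interval_mor j x = icoef x *: diter (ndiff Y) `|(j - i)%R|%N i j v.
Proof. exact: lfunE. Qed.

Lemma interval_mor_gen : interval_mor i (igen i l i) = v.
Proof.
rewrite interval_morE icoef_gen ?scale1r; last by rewrite /interval_supp; lia.
by rewrite subrr absz0 diter0 lfunE.
Qed.

End FromInterval.

Section Shift.
Variables (i1 i2 : int) (l1 l2 : nat) (l1N : (l1 < N)%N) (l2N : (l2 < N)%N).
Hypotheses (i21 : i2 <= i1) (il21 : i2 + l2%:Z <= i1 + l1%:Z).

Fact interval_shift_subproof :
  diter (ndiff (interval_cx k i2 l2 l2N)) l1.+1 i1 (i1 + l1.+1%:Z) (igen i2 l2 i1) = 0.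
Proof. by rewrite igen_diter //; apply: interval_objN; rewrite /interval_supp; lia. Qed.

(** The identity on the overlap of the two intervals and 0 elsewhere. *)
Definition interval_shift : mor (interval_cx k i1 l1 l1N) (interval_cx k i2 l2 l2N) :=
  interval_mor l1N interval_shift_subproof.

Lemma interval_shiftE j (x : interval_obj k i1 l1 j) :
  interval_shift j x = icoef x *: igen i2 l2 j.
Proof.
rewrite interval_morE; have [sj|nsj] := boolP (interval_supp i1 l1 j); last first.
  by rewrite icoef_out // !scale0r.
by rewrite igen_diter //; move: sj; rewrite /interval_supp; lia.
Qed.

End Shift.
End IntervalMor.

(** * The projective resolution of an interval complex *)

Section IntervalResolution.
Variables (k : fieldType) (N : nat) (lN : (N.-1 < N)%N).
Implicit Types Y : posNcomplex k N.

Local Notation P i := (interval_cx k i N.-1 lN).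

Section Yoneda.
Variables (i : int) (Y : Ncomplex k N).

Fact yoneda_subproof (y : Y i) :
  diter (ndiff Y) N.-1.+1 i (i + N.-1.+1%:Z) y = 0.
Proof. by rewrite (diter_over _ _ (@ndiffN k N Y)) ?lfunE // leqSpred. Qed.

Definition yoneda (y : Y i) : mor (P i) Y := interval_mor lN (yoneda_subproof y).

Lemma yoneda_gen y : yoneda y i (igen k i N.-1 i) = y.
Proof. exact: interval_mor_gen. Qed.

Definition eval_gen (c : mor (P i) Y) : Y i := c i (igen k i N.-1 i).

Lemma yonedaK : cancel yoneda eval_gen.
Proof. exact: yoneda_gen. Qed.

Lemma eval_genK : cancel eval_gen yoneda.
Proof. by move=> c; apply: interval_mor_eq; rewrite yoneda_gen. Qed.

Fact eval_gen_linear : linear eval_gen.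
Proof. by move=> a c d; rewrite /eval_gen /= !lfunE /= lfunE. Qed.
HB.instance Definition _ :=
  GRing.isLinear.Build k (mor (P i) Y) (Y i) _ eval_gen eval_gen_linear.

Fact yoneda_linear : linear yoneda.
Proof.
by move=> a x y; apply: (can_inj eval_genK); rewrite linearP /= !yonedaK.
Qed.
HB.instance Definition _ :=
  GRing.isLinear.Build k (Y i) (mor (P i) Y) _ yoneda yoneda_linear.

End Yoneda.

(** Any preimage under [g] of the image of the generator defines a lift, since [d^N = 0] imposes no
    condition on it. Taking [i] in [nat] keeps the complex positive. *)
Lemma interval_projective (i : nat) : projective (interval_pcx k i N.-1 lN).
Proof.
move=> A B g h gsurj.
have : h i (igen k i N.-1 i) \in limg (g i) by rewrite gsurj memvf.
case/memv_imgP => a _ ha; exists (yoneda a : mor (interval_pcx k i N.-1 lN) A).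
by apply: interval_mor_eq; rewrite comp_lfunE yoneda_gen ha.
Qed.

Variables (i l : nat) (hl : (l < N)%N).

(** The degrees [i, i+l+1, i+N, i+N+l+1, ...], with gaps alternately [l+1] and [N-l-1]. *)
Definition res_deg n : nat := (i + n./2 * N + odd n * l.+1)%N.

Lemma res_degSS n : res_deg n.+2 = (res_deg n + N)%N.
Proof. by rewrite /res_deg /= negbK mulSn; lia. Qed.

Lemma res_degS n : (res_deg n <= res_deg n.+1 <= res_deg n + N)%N.
Proof.
elim: n => [|n]; first by rewrite /res_deg /=; lia.
by rewrite res_degSS; lia.
Qed.

Definition res_obj n : posNcomplex k N := interval_pcx k (res_deg n) N.-1 lN.

Fact res_diff_le n : (res_deg n)%:Z <= (res_deg n.+1)%:Z.
Proof. by have := res_degS n; lia. Qed.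

Fact res_diff_top n :
  (res_deg n)%:Z + (N.-1)%:Z <= (res_deg n.+1)%:Z + (N.-1)%:Z.
Proof. by have := res_degS n; lia. Qed.

Definition res_diff n : mor (res_obj n.+1) (res_obj n) :=
  interval_shift k lN lN (res_diff_le n) (res_diff_top n).

Fact res_aug_le : i%:Z <= (res_deg 0)%:Z.
Proof. by rewrite /res_deg /=; lia. Qed.

Fact res_aug_top : i%:Z + l%:Z <= (res_deg 0)%:Z + (N.-1)%:Z.
Proof. by rewrite /res_deg /=; lia. Qed.

Definition res_aug : mor (res_obj 0) (interval_pcx k i l hl) :=
  interval_shift k lN hl res_aug_le res_aug_top.

Lemma res_aug_surj : surjective_mor res_aug.
Proof.
move=> j; apply/vspaceP => y; rewrite memvf; apply/memv_imgP.
exists (icoef y *: igen k (res_deg 0) N.-1 j); first exact: memvf.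
rewrite [RHS]interval_shiftE icoefZ.
have [sj|nsj] := boolP (interval_supp i l j).
  rewrite icoef_gen ?mulr1; first exact: igenE.
  by move: sj; rewrite /interval_supp /res_deg /=; lia.
by rewrite icoef_out // mul0r scale0r; exact: interval_objN.
Qed.

(** In each degree the spaces are 0 or [k] and the maps 0 or the identity, so exactness only says
    that where the middle term is [k], exactly one outer term is. *)
Lemma interval_shift_exact (i1 i2 i3 : int) (l1 l2 l3 : nat)
    (l1N : (l1 < N)%N) (l2N : (l2 < N)%N) (l3N : (l3 < N)%N)
    (i21 : i2 <= i1) (il21 : i2 + l2%:Z <= i1 + l1%:Z)
    (i32 : i3 <= i2) (il32 : i3 + l3%:Z <= i2 + l2%:Z) j :
  (interval_supp i2 l2 j -> interval_supp i1 l1 j = ~~ interval_supp i3 l3 j) ->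
  limg (interval_shift k l1N l2N i21 il21 j) =
  lker (interval_shift k l2N l3N i32 il32 j).
Proof.
move=> supp_eq; apply/vspaceP => y; rewrite memv_ker interval_shiftE.
have [s2|ns2] := boolP (interval_supp i2 l2 j); last first.
  by rewrite (interval_objN y ns2) mem0v icoef_out // scale0r eqxx.
have := supp_eq s2; have [s3|ns3] := boolP (interval_supp i3 l3 j) => s1.
  apply/memv_imgP/eqP => [[x _ ->]|y0].
    by rewrite interval_shiftE (@icoef_out _ _ _ _ x) ?s1 // icoefZ mul0r scale0r.
  exists 0; first exact: mem0v.
  have := congr1 (@icoef k i3 l3 j) y0; rewrite icoefZ icoef_gen // mulr1 => y00.
  by rewrite linear0 (igenE y) y00 /icoef big1 ?scale0r // => t _; rewrite mxE.
rewrite [X in _ = (X == 0)](interval_objN _ ns3) eqxx; apply/memv_imgP.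
exists (icoef y *: igen k i1 l1 j); first exact: memvf.
by rewrite interval_shiftE icoefZ icoef_gen ?s1 // mulr1; exact: igenE.
Qed.

Lemma res_exact0 : exact_at (res_diff 0) res_aug.
Proof.
move=> j; apply: interval_shift_exact; rewrite /interval_supp /res_deg /=; lia.
Qed.

(** The target of [res_diff n] ends in degree [res_deg n + N - 1], just below the start of the
    source of [res_diff n.+1]; within the middle support the two are complementary. *)
Lemma res_exactS n : exact_at (res_diff n.+1) (res_diff n).
Proof.
move=> j; apply: interval_shift_exact; rewrite /interval_supp res_degSS.
by have := res_degS n; lia.
Qed.

Definition interval_res : projres (interval_pcx k i l hl) :=
  ProjRes (fun n => @interval_projective (res_deg n)) res_aug_surj res_exact0 res_exactS.

(** * Amplitude cohomology from the resolution *)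

(** [res_diff n] sends the generator to the [m]-fold differential of the next generator, and [c]
    commutes with differentials. *)
Lemma eval_gen_res_diff n (Y : posNcomplex k N) (c : mor (res_obj n) Y) m :
  (res_deg n.+1)%:Z = (res_deg n)%:Z + m%:Z ->
  eval_gen (precomp (res_diff n) c : mor (P (res_deg n.+1)) Y) =
  diter (ndiff Y) m (res_deg n) (res_deg n.+1) (eval_gen c).
Proof.
move=> em; rewrite /eval_gen /= comp_lfunE.
have -> : res_diff n (res_deg n.+1) (igen k (res_deg n.+1) N.-1 (res_deg n.+1)) =
    diter (ndiff (res_obj n)) m (res_deg n) (res_deg n.+1)
      (igen k (res_deg n) N.-1 (res_deg n)).
  by rewrite (igen_diter _ _ (lexx _) em); exact: interval_mor_gen.
by rewrite -!comp_lfunE mor_diter.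
Qed.

Lemma posNcomplex_neg0 Y (j : int) (v : Y j) : j <= -1 -> v = 0.
Proof.
move=> /(pos_cxP Y)/eqP; rewrite dimv_eq0 => /eqP Y0.
by apply/eqP; rewrite -memv0 -Y0 memvf.
Qed.

(** The gap after [res_deg n] has to be [a] and the gap before it [N - a]. For [n = 0] nothing comes
    before, and [i < N - a] makes the incoming map of [AH] start in a negative degree, where [Y] is
    0. *)
Lemma AH_ext_interval_res (Y : posNcomplex k N) a n :
  (res_deg n.+1 = res_deg n + a)%N ->
  match n with
  | 0 => i < N - a
  | m.+1 => res_deg n == res_deg m + (N - a)
  end%N ->
  lmod_iso (AH Y a (res_deg n)%:Z) (ext_of_res interval_res n Y).
Proof.
move=> ea en; have [U [f [-> fE]]] := ext_of_resE interval_res n Y.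
have ker_iff (c : mor (res_obj n) Y) : precomp (res_diff n) c = 0 <->
    diter (ndiff Y) a (res_deg n) ((res_deg n)%:Z + a%:Z) (eval_gen c) = 0.
  have ez : (res_deg n.+1)%:Z = (res_deg n)%:Z + a%:Z by rewrite ea.
  rewrite -ez -(eval_gen_res_diff c ez); split=> [->|c0]; first exact: linear0.
  by apply: (can_inj (@eval_genK _ Y)); rewrite c0 linear0.
have im_iff (c : mor (res_obj n) Y) : (exists u, f u = c) <->
    exists u, diter (ndiff Y) (N - a) ((res_deg n)%:Z - (N - a)%N%:Z) (res_deg n) u
      = eval_gen c.
  rewrite fE; case: n c en {ea f fE ker_iff} => [|n] c en /=.
    split=> [->|[u]]; first by exists 0; rewrite !linear0.
    rewrite (posNcomplex_neg0 u); last by rewrite /res_deg /=; lia.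
    by rewrite linear0 => c0; rewrite -(eval_genK c) -c0 linear0.
  have -> : (res_deg n.+1)%:Z - (N - a)%N%:Z = (res_deg n)%:Z by lia.
  have ez : (res_deg n.+1)%:Z = (res_deg n)%:Z + (N - a)%N%:Z by lia.
  split=> [[u uc]|[u uc]].
    by exists (eval_gen u); rewrite -(eval_gen_res_diff u ez) -uc.
  exists (yoneda u); apply: (can_inj (@eval_genK _ Y)).
  by rewrite -uc [LHS](eval_gen_res_diff _ ez) yonedaK.
apply: (homology_iso (phi := @yoneda _ Y) (psi := @eval_gen _ Y)).
- by move=> v v0; apply/ker_iff; rewrite yonedaK.
- by move=> v; rewrite -{1}(yonedaK v) => /im_iff.
- by move=> v v0; apply/ker_iff.
- by move=> v /im_iff.
- by move=> v v0; exists 0; rewrite /= yonedaK subrr linear0.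
- by move=> v v0; exists 0; rewrite /= eval_genK subrr linear0.
Qed.

End IntervalResolution.

Theorem theorem4p6 (k : fieldType) (N : nat) (N_gt0 : (0 < N)%N)
    (M : posNcomplex k N) (a : nat) (ha : (0 < a < N)%N)
    (j q e : nat) (hj : j = (q * N + e)%N) (he : (e < N)%N) :
  ((e < N - a)%N ->
     lmod_iso (AH M a j%:Z)
              (Ext (2 * q) (interval_pcx k e (a - 1) (amplitude_lt ha)) M)) /\
  ((N - a <= e)%N ->
     lmod_iso (AH M a j%:Z)
              (Ext (2 * q + 1)
                   (interval_pcx k (e - (N - a)) (N - a - 1) (coamplitude_lt ha)) M)).
Proof.
have lN : (N.-1 < N)%N by lia.
split=> eb; rewrite /Ext.
(* With [l + 1 = a], even steps sit in degrees [e + q N] and are followed by a gap [a]. *)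
- have ej : j = res_deg N e (a - 1) (2 * q).
    by rewrite /res_deg mul2n doubleK odd_double; lia.
  rewrite ej; apply: lmod_iso_trans (ext_of_res_iso (interval_res _ lN _ _) _ _ _).
  apply: AH_ext_interval_res.
    by rewrite /res_deg mul2n /= uphalf_double doubleK odd_double; lia.
  (* For [q = 0] the degree 0 condition is the assumption [e < N - a]. *)
  case: q {hj ej} => [|q]; first by rewrite muln0.
  rewrite mul2n doubleS /res_deg /= uphalf_double doubleK negbK odd_double; lia.
(* With [b = N - a] and [l + 1 = b], odd steps sit in degrees [(e - b) + q N + b = j], preceded by a
   gap [b] and followed by [N - b = a]. *)
- have ej : j = res_deg N (e - (N - a)) (N - a - 1) (2 * q + 1).
    by rewrite addn1 /res_deg mul2n /= uphalf_double odd_double; lia.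
  rewrite ej; apply: lmod_iso_trans (ext_of_res_iso (interval_res _ lN _ _) _ _ _).
  rewrite addn1 in ej *; apply: AH_ext_interval_res.
    by rewrite /res_deg mul2n /= uphalf_double doubleK negbK odd_double; lia.
  by rewrite /res_deg mul2n /= uphalf_double doubleK odd_double; lia.
Qed.
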